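(* The modal logic $\mathsf K$ is sound for provability models: for every provability model $\mathcal P$ and every formula $A$ with $\mathsf K\vdash A$, we have $\mathcal P,w\Vdash A$ for all worlds $w$ of $\mathcal P$.
   Context: $\mathsf K$ is the smallest normal modal logic in $\mathcal L_\Box$ (classical tautologies, $\Box(A\to B)\to(\Box A\to\Box B)$, modus ponens, necessitation). Language $\mathcal L_\Box$: formulas built from atomic propositions and $\bot$ using $\to$ and a unary $\Box$. A formula is purely modal if it is a Boolean combination of formulas of the form $\Box B$. A theory is a pair of a set of axioms and a set of inference rules (finitely many premises, one conclusion); $\mathsf T\vdash A$ means derivability from axioms by rules. A theory is classical if modus ponens is one of its rules and all classical tautologies are derivable. A provability pre-model is $\mathcal P=(W,\sqsubset,\{L_w\}_{w\in W^\sqsubset},V)$ with $W$ nonempty, $\sqsubset$ a binary relation on $W$, $V\subseteq W\times\mathrm{atoms}$, $W^\sqsubset=\{u:\exists v\,(v\sqsubset u)\}$, and a theory $L_w$ for each $w\in W^\sqsubset$. Satisfaction: atoms via $V$, $\bot$ never holds, $\to$ classical, $\mathcal P,w\Vdash\Box A$ iff $L_u\vdash A$ for all $u$ with $w\sqsubset u$. With $\sqsubset^+$ the transitive closure, $\mathcal P,w\Vdash^+A$ iff there is $u\sqsubset w$ with $\mathcal P,v\Vdash A$ for all $v$ such that $u\sqsubset^+v$. A provability model is a pre-model in which every $L_w$ is classical and which satisfies modal completeness: for every $w\in W^\sqsubset$ and purely modal $A$, $\mathcal P,w\Vdash^+A$ implies $L_w\vdash A$. *)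

(* Defs.v *)
From Stdlib Require Import List Relations Bool.
Import ListNotations.

Set Implicit Arguments.

Section Language.

Variable Atom : Type.

Inductive form : Type :=
| Var (p : Atom)
| Bot
| Imp (A B : form)
| Box (A : form).

(* Classical tautologies of the modal language: atoms and boxed formulas are
   both treated as propositional variables, valued by [va] and [vb]. *)
Fixpoint beval (va : Atom -> bool) (vb : form -> bool) (A : form) : bool :=
  match A with
  | Var p => va p
  | Bot => false
  | Imp B C => implb (beval va vb B) (beval va vb C)
  | Box B => vb B
  end.

Definition tautology (A : form) : Prop :=
  forall (va : Atom -> bool) (vb : form -> bool), beval va vb A = true.

Inductive purely_modal : form -> Prop :=
| pm_box : forall A, purely_modal (Box A)
| pm_bot : purely_modal Bot
| pm_imp : forall A B,
    purely_modal A -> purely_modal B -> purely_modal (Imp A B).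

(* A rule is the set of its instances: [r ps c] says that [c] may be inferred
   from the finite list of premises [ps] by [r]. *)
Definition rule : Type := list form -> form -> Prop.

Record theory : Type := Theory {
  axioms : form -> Prop;
  rules : rule -> Prop
}.

Inductive derivable (T : theory) : form -> Prop :=
| der_axiom : forall A, axioms T A -> derivable T A
| der_rule : forall (r : rule) (ps : list form) (A : form),
    rules T r -> r ps A ->
    (forall B, In B ps -> derivable T B) ->
    derivable T A.

Definition modus_ponens : rule :=
  fun ps C => exists A, ps = [Imp A C; A].

Definition necessitation : rule :=
  fun ps C => exists A, ps = [A] /\ C = Box A.

Definition classical (T : theory) : Prop :=
  rules T modus_ponens /\ (forall A, tautology A -> derivable T A).

Definition K : theory := {|
  axioms := fun A =>
    tautology A \/
    exists B C, A = Imp (Box (Imp B C)) (Imp (Box B) (Box C));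
  rules := fun r => r = modus_ponens \/ r = necessitation
|}.

Definition non_initial (W : Type) (R : W -> W -> Prop) : Type :=
  {u : W | exists v, R v u}.

Record pre_model : Type := PreModel {
  world : Type;
  world_inhabited : inhabited world;
  acc : world -> world -> Prop;
  thy : non_initial acc -> theory;
  val : world -> Atom -> Prop
}.

Fixpoint sat (P : pre_model) (w : world P) (A : form) : Prop :=
  match A with
  | Var p => val P w p
  | Bot => False
  | Imp B C => sat P w B -> sat P w C
  | Box B => forall u : non_initial (acc P),
      acc P w (proj1_sig u) -> derivable (thy P u) B
  end.

Definition sat_plus (P : pre_model) (w : world P) (A : form) : Prop :=
  exists u, acc P u w /\
    forall v, clos_trans (world P) (acc P) u v -> sat P v A.

Definition modal_completeness (P : pre_model) : Prop :=
  forall (w : non_initial (acc P)) (A : form),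
    purely_modal A -> sat_plus P (proj1_sig w) A -> derivable (thy P w) A.

Definition provability_model (P : pre_model) : Prop :=
  (forall w : non_initial (acc P), classical (thy P w)) /\
  modal_completeness P.

End Language.

(* Main.v *)
(** By induction on the derivation in [K], every theorem is both true at all
    worlds and derivable in all the theories [L_u].  The second half is what
    necessitation needs at the worlds.  It holds because the distribution axioms
    and the conclusions of necessitation are purely modal: being true
    everywhere, they are derivable in every [L_u] by modal completeness. *)

From Stdlib Require Import List ClassicalDescription.
Require Import Defs.
Import ListNotations.

Lemma derivable_mp (Atom : Type) (T : theory Atom) (A B : form Atom) :
  classical T -> derivable T (Imp A B) -> derivable T A -> derivable T B.
Proof.
  intros [Hmp _] HAB HA.
  apply der_rule with (r := @modus_ponens Atom) (ps := [Imp A B; A]).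
  - exact Hmp.
  - now exists A.
  - now intros C [<- | [<- | []]].
Qed.

(** Tautologies are tested by Boolean valuations, whereas satisfaction lives in [Prop]; informative
    excluded middle bridges the two. *)
Definition truth_value (Q : Prop) : bool :=
  if excluded_middle_informative Q then true else false.

Lemma truth_value_spec (Q : Prop) : truth_value Q = true <-> Q.
Proof.
  unfold truth_value.
  now destruct (excluded_middle_informative Q).
Qed.

(** Satisfaction at [w] induces a Boolean valuation in which boxed formulas are opaque variables, so
    the [Box] case is immediate. *)
Lemma beval_sat (Atom : Type) (P : pre_model Atom) (w : world P)
    (A : form Atom) :
  beval (fun p => truth_value (val P w p))
        (fun B => truth_value (sat P w (Box B))) A = true
  <-> sat P w A.
Proof.
  induction A as [p | | B IHB C IHC | B _].
  - apply truth_value_spec.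
  - now split.
  - cbn [beval sat].
    rewrite <- IHB, <- IHC.
    destruct (beval _ _ B), (beval _ _ C); cbn; intuition congruence.
  - apply truth_value_spec.
Qed.

Lemma tautology_sat (Atom : Type) (P : pre_model Atom) (A : form Atom) :
  tautology A -> forall w : world P, sat P w A.
Proof.
  intros HA w.
  apply beval_sat, HA.
Qed.

Lemma purely_modal_valid_derivable (Atom : Type) (P : pre_model Atom)
    (A : form Atom) :
  modal_completeness P -> purely_modal A -> (forall w : world P, sat P w A) ->
  forall u : non_initial (acc P), derivable (thy P u) A.
Proof.
  intros HP HA Hsat u.
  apply HP; [exact HA |].
  (* The predecessor that makes [u] non-initial is the witness for [sat_plus]. *)
  destruct (proj2_sig u) as [v Hv].
  exists v; auto.
Qed.

Lemma K_sat_and_derivable (Atom : Type) (P : pre_model Atom) (A : form Atom) :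
  provability_model P -> derivable (K Atom) A ->
  (forall w : world P, sat P w A) /\
  (forall u : non_initial (acc P), derivable (thy P u) A).
Proof.
  intros [Hcl Hmc] HA.
  induction HA as [A [Htaut | (B & C & ->)] | r ps A [-> | ->] Hr _ IH].
  - split.
    + now apply tautology_sat.
    + intros u. now apply Hcl.
  - assert (Hsat : forall w : world P,
               sat P w (Imp (Box (Imp B C)) (Imp (Box B) (Box C)))).
    { intros w HBC HB u Hu.
      (* Distribution holds at [w] because each classical [thy P u] is closed under modus ponens. *)
      apply derivable_mp with B; auto. }
    split; [exact Hsat |].
    apply purely_modal_valid_derivable; auto using purely_modal.
  - destruct Hr as [B ->].
    destruct (IH (Imp B A)) as [HsI HdI]; [cbn; auto |].
    destruct (IH B) as [HsB HdB]; [cbn; auto |].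
    split.
    + intros w. exact (HsI w (HsB w)).
    + intros u. now apply derivable_mp with B.
  - destruct Hr as (B & -> & ->).
    destruct (IH B) as [_ HdB]; [cbn; auto |].
    assert (Hsat : forall w : world P, sat P w (Box B)) by (intros w u _; auto).
    split; [exact Hsat |].
    apply purely_modal_valid_derivable; auto using purely_modal.
Qed.

Theorem theorem3p6 (Atom : Type) (P : pre_model Atom) (HP : provability_model P)
    (A : form Atom) (HA : derivable (K Atom) A) (w : world P) :
  sat P w A.
Proof.
  now apply K_sat_and_derivable.
Qed.
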